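(* Let $\mathcal{A}$ be a unital $C^*$-algebra, let $n\ge 1$, let $a_k,b_k,x_k\in\mathcal{A}$ for $k=1,2,\ldots,n$, and let $f\in S(\mathcal{A})$. Then for every $r\in\mathbb{N}$, $$\left| f\left(\sum_{k=1}^n a_k^*x_kb_k \right) \right|^{r} \leq \frac{n^{r-1}}{\sqrt{2}} \left| f\left(\sum_{k=1}^n \big((b_k^*|x_k| b_k)^r + i (a_k^*|x_k^*| a_k)^r\big) \right)\right|.$$ Furthermore, for every $r\in\mathbb{N}$, $$v^{r}\left( \sum_{k=1}^n a_k^*x_kb_k\right) \leq \frac{n^{r-1}}{\sqrt{2}}\, v\left(\sum_{k=1}^n \big( (b_k^*|x_k| b_k)^{r}+ i (a_k^*|x_k^*|a_k)^{r} \big)\right).$$ In particular, for $r=1$, $$v\left( \sum_{k=1}^n a_k^*x_kb_k\right) \leq \frac{1}{\sqrt{2}}\, v\left(\sum_{k=1}^n \big( b_k^*|x_k| b_k+ i a_k^*|x_k^*|a_k \big)\right).$$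
   Context: $\mathcal{A}$ is a unital $C^*$-algebra with unit $e$. $S(\mathcal{A})$ is the set of normalized states, i.e. continuous linear functionals $f$ on $\mathcal{A}$ with $f(e)=\|f\|=1$ (equivalently, positive linear functionals with $f(e)=1$). The algebraic numerical radius of $a\in\mathcal{A}$ is $v(a)=\sup\{|f(a)|: f\in S(\mathcal{A})\}$, and $v^r(a)$ means $(v(a))^r$. $|a|=(a^*a)^{1/2}$, so $|a^*|=(aa^* )^{1/2}$. $i=\sqrt{-1}$. $\mathbb{N}=\{1,2,\ldots\}$. *)

(* Defs.v *)
From HB Require Import structures.
From mathcomp Require Import all_boot all_order all_algebra complex.
From mathcomp Require Import boolp classical_sets reals constructive_ereal ereal.
From mathcomp Require Import topology normedtype.

Set Implicit Arguments.
Unset Strict Implicit.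
Unset Printing Implicit Defensive.

Import Order.TTheory GRing.Theory Num.Theory.
Import numFieldNormedType.Exports.

Local Open Scope classical_set_scope.
Local Open Scope complex_scope.
Local Open Scope ring_scope.

(* The norm of a normed module over R[i] takes its values in R[i] (in its
   nonnegative reals), so the two axioms on norms are (in)equalities there.
   The product is part of the mixin, and the ring structure is an instance on
   the resulting type, because the hierarchy has no join of rings and normed
   modules below [numDomainType]. *)
HB.mixin Record isCStarAlgebra (R : realType) A
    of CompleteNormedModule R[i] A := {
  cstar_one : A;
  cstar_mul : A -> A -> A;
  cstar_mulA : associative cstar_mul;
  cstar_mul1l : left_id cstar_one cstar_mul;
  cstar_mul1r : right_id cstar_one cstar_mul;
  cstar_mulDl : left_distributive cstar_mul +%R;
  cstar_mulDr : right_distributive cstar_mul +%R;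
  cstar_one_neq0 : cstar_one != 0;
  cstar_scaleAl : forall (c : R[i]) (x y : A),
    c *: cstar_mul x y = cstar_mul (c *: x) y;
  cstar_scaleAr : forall (c : R[i]) (x y : A),
    c *: cstar_mul x y = cstar_mul x (c *: y);
  star : A -> A;
  starK : involutive star;
  starD : forall x y : A, star (x + y) = star x + star y;
  starZ : forall (c : R[i]) (x : A), star (c *: x) = c^*%C *: star x;
  starM : forall x y : A, star (cstar_mul x y) = cstar_mul (star y) (star x);
  norm_mul_le : forall x y : A, `|cstar_mul x y| <= `|x| * `|y|;
  norm_star_mul : forall x : A, `|cstar_mul (star x) x| = `|x| ^+ 2
}.

#[short(type="cstarAlgType")]
HB.structure Definition CStarAlgebra (R : realType) :=
  {A of CompleteNormedModule R[i] A & isCStarAlgebra R A}.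

#[non_forgetful_inheritance,
  warnings="-redundant-canonical-projection"]
HB.instance Definition _ (R : realType) (A : cstarAlgType R) :=
  GRing.Zmodule_isNzRing.Build (CStarAlgebra.sort A)
    cstar_mulA cstar_mul1l cstar_mul1r cstar_mulDl cstar_mulDr cstar_one_neq0.
#[non_forgetful_inheritance,
  warnings="-redundant-canonical-projection"]
HB.instance Definition _ (R : realType) (A : cstarAlgType R) :=
  GRing.Lmodule_isLalgebra.Build R[i] (CStarAlgebra.sort A) cstar_scaleAl.
#[non_forgetful_inheritance,
  warnings="-redundant-canonical-projection"]
HB.instance Definition _ (R : realType) (A : cstarAlgType R) :=
  GRing.Lalgebra_isAlgebra.Build R[i] (CStarAlgebra.sort A) cstar_scaleAr.

Notation "x ^!*" := (star x) (at level 1, left associativity, format "x ^!*").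

Section CStarAlgebraTheory.
Context {R : realType} {A : cstarAlgType R}.
Implicit Types (a b : A) (f : {scalar A}).

Definition invertible a := exists2 b, a * b = 1 & b * a = 1.

Definition spectrum a : set R[i] := [set l | ~ invertible (l%:A - a)].

(* In R[i], [0 <= l] says that l is real and nonnegative. *)
Definition positive a : Prop :=
  a^!* = a /\ forall l : R[i], spectrum a l -> 0 <= l.

(* The positive square root of a, which exists and is unique if a is positive;
   the default value 0 is for the other a. *)
Definition cstar_sqrt a : A := xget 0 [set b | positive b /\ b ^+ 2 = a].

Definition cstar_abs a : A := cstar_sqrt (a^!* * a).

(* [normc z : R] is the modulus of [z : R[i]]; the supremum is taken in the
   extended reals. *)
Definition opnorm f : \bar R :=
  ereal_sup [set (ComplexField.Normc.normc (f a))%:E | a in [set a | `|a| <= 1]].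

Definition state f : Prop :=
  [/\ continuous f, f 1 = 1 & opnorm f = 1%:E].

Definition numradius a : R :=
  sup [set ComplexField.Normc.normc (f a) | f in [set f | state f]].

End CStarAlgebraTheory.

(* Main.v *)
(* Call a self-adjoint h positive if the ball of some radius M around M
   contains h.  Such an h has a positive square root, obtained by a fixed-point
   iteration, and squares of self-adjoint elements are positive because s + i t
   has norm sqrt N when s, t are commuting self-adjoint elements with
   s^2 + t^2 = N.  A self-adjoint b with b + e invertible for all e > 0 is
   positive, since a positive invertible element stays positive when a small
   scalar is subtracted; so positivity agrees with its spectral definition
   (no spectral radius formula is needed), and Kaplansky's argument makes
   x^* x positive.

   From x |x| = |x^*| x, completing the square gives, for a state f,
   2 |f(a^* x b)| <= f(b^* |x| b) + f(a^* |x^*| a).  Convexity of the r-th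
   power and the Jensen inequality f(p)^r <= f(p^r), p positive, then bound
   |f(sum a_k^* x_k b_k)|^r by n^(r-1) (u + v) / 2 with u + i v the value of f
   on the right-hand side, and u + v <= sqrt 2 |u + i v|. *)

Require Import Defs.
From HB Require Import structures.
From mathcomp Require Import all_boot all_order all_algebra complex.
From mathcomp Require Import boolp classical_sets reals constructive_ereal ereal.
From mathcomp Require Import topology normedtype.
From mathcomp Require Import exp ring lra.
From Stdlib Require Ncring Ncring_tac.
Import Order.TTheory GRing.Theory Num.Theory.
Import numFieldNormedType.Exports.
Import ComplexField.Normc.
Local Open Scope ring_scope.
Local Open Scope complex_scope.

(** * Real-valued norm *)

Section Norm.
Context {R : realType} {A : cstarAlgType R}.
Implicit Types (a b h x y : A) (M N : R).

(** By [nrmE] the real part loses nothing, and real values suit [lra] and [nra]. *)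
Definition nrm x : R := complex.Re (`|x| : R[i]).

Lemma nrmE x : `|x| = (nrm x)%:C.
Proof.
have : 0 <= `|x| by [].
rewrite /nrm; case: (`|x|) => p q; rewrite lecE /= => /andP[/eqP q0 _].
by rewrite q0.
Qed.

Lemma nrm_ge0 x : 0 <= nrm x.
Proof. by rewrite -lecR -nrmE normr_ge0. Qed.

Lemma nrm_eq0 x : nrm x = 0 -> x = 0.
Proof. by move=> x0; apply/eqP; rewrite -normr_eq0 nrmE x0. Qed.

Lemma nrm0 : nrm 0 = 0.
Proof. by rewrite /nrm normr0. Qed.

Lemma nrmN x : nrm (- x) = nrm x.
Proof. by rewrite /nrm normrN. Qed.

Lemma nrmB x y : nrm (x - y) = nrm (y - x).
Proof. by rewrite -nrmN opprB. Qed.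

Lemma nrmD x y : nrm (x + y) <= nrm x + nrm y.
Proof. by rewrite -lecR rmorphD/= -!nrmE ler_normD. Qed.

Lemma nrmM x y : nrm (x * y) <= nrm x * nrm y.
Proof. by rewrite -lecR rmorphM/= -!nrmE; exact: norm_mul_le. Qed.

Lemma nrmZ (c : R[i]) x : nrm (c *: x) = normc c * nrm x.
Proof.
apply: (@complexI R); rewrite rmorphM/= -!nrmE normrZ.
by congr (_ * _); case: c => p q; rewrite normc_def.
Qed.

Lemma normc_real M : normc M%:C = `|M|.
Proof. by rewrite /= expr0n /= addr0 sqrtr_sqr. Qed.

Lemma nrmZr M x : nrm (M%:C *: x) = `|M| * nrm x.
Proof. by rewrite nrmZ normc_real. Qed.

Lemma nrmZi x : nrm ('i%C *: x) = nrm x.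
Proof. by rewrite nrmZ /= expr0n expr1n add0r sqrtr1 mul1r. Qed.

Lemma star_mul x y : (x * y)^!* = y^!* * x^!*.
Proof. exact: starM. Qed.

Lemma star_inj : injective (@star R A).
Proof. exact: inv_inj (@starK R A). Qed.

Lemma star0 : (0 : A)^!* = 0.
Proof. by apply: (addrI (0^!*)); rewrite -starD !addr0. Qed.

Lemma starN x : (- x)^!* = - x^!*.
Proof. by apply: (addrI (x^!*)); rewrite -starD !subrr star0. Qed.

Lemma starB x y : (x - y)^!* = x^!* - y^!*.
Proof. by rewrite starD starN. Qed.

Lemma star1 : (1 : A)^!* = 1.
Proof. by rewrite -[LHS]mulr1 -{2}[1]starK -star_mul mulr1 starK. Qed.

Lemma starZr M x : (M%:C *: x)^!* = M%:C *: x^!*.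
Proof. by rewrite starZ /= oppr0. Qed.

Lemma starZi x : ('i%C *: x)^!* = - ('i%C *: x^!*).
Proof.
rewrite starZ -scaleNr; congr (_ *: _); apply/eqP.
by rewrite eq_complex /= oppr0 !eqxx.
Qed.

Lemma nrm_star_mul x : nrm (x^!* * x) = nrm x ^+ 2.
Proof.
apply: (@complexI R); rewrite rmorphXn/= -!nrmE; exact: norm_star_mul.
Qed.

Lemma nrm_star x : nrm (x^!*) = nrm x.
Proof.
suff le y : nrm y <= nrm (y^!*).
  by apply/eqP; rewrite eq_le le -{2}[x]starK le.
have [->|y0] := eqVneq (nrm y) 0; first exact: nrm_ge0.
have yp : 0 < nrm y by rewrite lt_def y0 nrm_ge0.
by rewrite -(ler_pM2r yp) -expr2 -nrm_star_mul nrmM.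
Qed.

Lemma nrm_sqr h : h^!* = h -> nrm (h * h) = nrm h ^+ 2.
Proof. by move=> hs; rewrite -nrm_star_mul hs. Qed.

Lemma star_mul_eq0 x : x^!* * x = 0 -> x = 0.
Proof.
move=> xx; apply: nrm_eq0; apply/eqP; rewrite -sqrf_eq0 -nrm_star_mul xx.
by rewrite nrm0.
Qed.

Lemma sqr_eq0 h : h^!* = h -> h * h = 0 -> h = 0.
Proof. by move=> hs hh; apply: star_mul_eq0; rewrite hs. Qed.

Definition sc M : A := M%:C *: 1.

Lemma scD M N : sc (M + N) = sc M + sc N.
Proof. by rewrite /sc rmorphD scalerDl. Qed.
Lemma scN M : sc (- M) = - sc M.
Proof. by rewrite /sc rmorphN scaleNr. Qed.
Lemma scB M N : sc (M - N) = sc M - sc N.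
Proof. by rewrite scD scN. Qed.
Lemma sc0 : sc 0 = 0.
Proof. by rewrite /sc scale0r. Qed.
Lemma sc1 : sc 1 = 1.
Proof. by rewrite /sc scale1r. Qed.
Lemma mul_sc M x : sc M * x = M%:C *: x.
Proof. by rewrite /sc -scalerAl mul1r. Qed.
Lemma mulx_sc M x : x * sc M = M%:C *: x.
Proof. by rewrite /sc -scalerAr mulr1. Qed.
Lemma scC M x : sc M * x = x * sc M.
Proof. by rewrite mul_sc mulx_sc. Qed.
Lemma scM M N : sc (M * N) = sc M * sc N.
Proof. by rewrite mul_sc /sc scalerA rmorphM. Qed.
Lemma star_sc M : (sc M)^!* = sc M.
Proof. by rewrite starZr star1. Qed.

Lemma nrm1 : nrm 1 = 1.
Proof.
have := nrm_star_mul 1; rewrite star1 mulr1 => /eqP.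
rewrite expr2 -subr_eq0 -{1}[nrm 1]mulr1 -mulrBr mulf_eq0 => /orP[|].
  by move=> /eqP/nrm_eq0/eqP; rewrite oner_eq0.
by rewrite subr_eq0 => /eqP.
Qed.

Lemma nrm_sc M : nrm (sc M) = `|M|.
Proof. by rewrite nrmZr nrm1 mulr1. Qed.

(** The scalar sequence [v] is nondecreasing and bounded, hence Cauchy; this passes to [w], and
    completeness gives the limit. It serves the square-root iteration and the Neumann series. *)
Lemma dominated_limit (w : nat -> A) (v : nat -> R) (B : R) :
    (forall n, nrm (w n.+1 - w n) <= v n.+1 - v n) -> (forall n, v n <= B) ->
  exists l, forall e : R, 0 < e -> exists N : nat, forall n, (N <= n)%N ->
    nrm (w n - l) < e.
Proof.
move=> wv vB.
have dom m k : nrm (w (k + m)%N - w m) <= v (k + m)%N - v m.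
  elim: k => [|k IH]; first by rewrite !subrr nrm0.
  rewrite addSn -(subrK (w (k + m)%N) (w (k + m).+1)) -addrA.
  have := nrmD (w (k + m).+1 - w (k + m)%N) (w (k + m)%N - w m).
  have := wv (k + m)%N. lra.
have Cauchy (e : R) : 0 < e -> exists N : nat, forall n, (N <= n)%N ->
    nrm (w n - w N) < e.
  move=> e0.
  have supE : has_sup (range v).
    by split; [exists (v 0%N); exists 0%N|exists B => _ [n _ <-]].
  have [_ [N _ <-] ltN] := sup_adherent e0 supE.
  exists N => n Nn; rewrite -(subnK Nn).
  apply: le_lt_trans (dom _ _) _; rewrite ltrBlDr.
  apply: le_lt_trans (_ : sup (range v) < _); last by rewrite -ltrBlDl.
  by apply: sup_upper_bound => //; exists (n - N + N)%N.
have /cvg_ex[l wl] : cvg (w @ \oo)%classic.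
  apply: cauchy_cvg; apply: cauchy_exP => e e0.
  have eE : e = (complex.Re e)%:C.
    by move: e0; rewrite ltcE /=; case: (e) => p q /= /andP[/eqP ->].
  have [|N NP] := Cauchy (complex.Re e).
    by move: e0; rewrite ltcE => /andP[].
  exists (w N); exists N => // n /= Nn.
  by rewrite -ball_normE /= eE nrmE ltcR nrmB NP.
exists l => e e0.
have eC : 0 < e%:C by rewrite ltcR.
move/cvgr_dist_lt: wl => /(_ _ eC)[N _ NP]; exists N => n Nn.
by have := NP n Nn; rewrite /= nrmE ltcR nrmB.
Qed.

End Norm.

(** * Square roots and positive elements *)

Section Order.
Context {R : realType} {A : cstarAlgType R}.
Implicit Types (a b h x y : A) (M N : R).

#[local] Instance ncring_ops :
  @Ncring.Ring_ops A 0 1 +%R *%R (fun x y => x - y) -%R eq := {}.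
#[local] Instance ncring_laws : Ncring.Ring (Ro := ncring_ops).
Proof.
constructor.
- exact: RelationClasses.eq_equivalence.
1-4: by repeat intro; congruence.
- exact: add0r.
- exact: addrC.
- exact: addrA.
- exact: mul1r.
- exact: mulr1.
- exact: mulrA.
- exact: mulrDl.
- by move=> x y z; exact: mulrDr.
- by [].
- exact: subrr.
Qed.

Ltac ncring := Ncring_tac.non_commutative_ring.

(** Transfers identities from the iterates to their limit. *)
Lemma nrm_le_eps x (C : R) : (forall e, 0 < e -> nrm x <= C * e) -> x = 0.
Proof.
move=> small; apply: nrm_eq0; apply/eqP; rewrite eq_le nrm_ge0 andbT leNgt.
apply/negP => x0.
have C0 : 0 < C by have := small 1 ltr01; lra.
have eC : 0 < nrm x / (C * 2) by rewrite divr_gt0// mulr_gt0.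
have := small _ eC.
have -> : C * (nrm x / (C * 2)) = nrm x / 2 by field; rewrite gt_eqF.
lra.
Qed.

Definition halve x := (2^-1 : R)%:C *: x.

Lemma halve_add x : halve x + halve x = x.
Proof.
rewrite /halve -scalerDl -rmorphD.
have -> : 2^-1 + 2^-1 = 1 :> R by lra.
by rewrite scale1r.
Qed.

(* Dominating the iterates of [l |-> (u + l^2) / 2] by the scalar ones for
   [u = 1] gives a solution of [l = (u + l^2) / 2] as soon as [nrm u <= 1];
   then [(1 - l)^2 = 1 - u]. *)
Lemma sqrt_unit_ball h : h^!* = h -> nrm (1 - h) <= 1 ->
  exists s, [/\ s^!* = s, nrm (1 - s) <= 1, s * s = h &
    forall c, c * h = h * c -> c * s = s * c].
Proof.
move=> hs h1.
set u := 1 - h.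
have us : u^!* = u by rewrite starB star1 hs.
pose w := fix w n := if n is n.+1 then halve (u + w n * w n) else 0.
pose v := fix v n : R := if n is n.+1 then (1 + v n * v n) / 2 else 0.
have v01 n : 0 <= v n <= 1 by elim: n => [|n] /=; nra.
have wv n : nrm (w n) <= v n.
  elim: n => [|n IH] /=; first by rewrite nrm0.
  rewrite nrmZr ger0_norm ?invr_ge0 ?ler0n//.
  have := nrmD u (w n * w n); have := nrmM (w n) (w n); have := nrm_ge0 (w n).
  rewrite -/u in h1; nra.
have dwv n : nrm (w n.+1 - w n) <= v n.+1 - v n.
  elim: n => [|n IH] /=.
    rewrite mulr0 addr0 subr0 nrmZr ger0_norm ?invr_ge0 ?ler0n//.
    rewrite -/u in h1; lra.
  have -> : halve (u + w n.+1 * w n.+1) - halve (u + w n * w n) =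
      halve ((w n.+1 - w n) * w n.+1 + w n * (w n.+1 - w n)).
    rewrite /halve -scalerBr; congr (_ *: _); ncring.
  rewrite nrmZr ger0_norm ?invr_ge0 ?ler0n//.
  have := nrmD ((w n.+1 - w n) * w n.+1) (w n * (w n.+1 - w n)).
  have := nrmM (w n.+1 - w n) (w n.+1); have := nrmM (w n) (w n.+1 - w n).
  have := nrm_ge0 (w n.+1 - w n).
  have := wv n; have := wv n.+1; have := v01 n; have := v01 n.+1.
  have := nrm_ge0 (w n); have := nrm_ge0 (w n.+1).
  have vE : v n.+1 = (1 + v n * v n) / 2 by [].
  rewrite -/(v n.+1) -/(w n.+1); move: IH vE.
  move: (nrm _) (nrm _) (nrm _) (nrm _) (nrm _) (nrm _) (v n.+1) (v n).
  move=> p q r t' t d v1 v0 dv v1E t0 t'0 v10 v00 tv tv' d0 *.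
  have le1 : d * t <= (v1 - v0) * v1 by apply: ler_pM.
  have le2 : t' * d <= v0 * (v1 - v0) by apply: ler_pM.
  lra.
have [|l lim] := dominated_limit w v 1 dwv.
  by move=> n; case/andP: (v01 n).
have ws n : (w n)^!* = w n.
  by elim: n => [|n IH]; rewrite ?star0//= starZr starD star_mul IH us.
have wc n c : c * u = u * c -> c * w n = w n * c.
  move=> cu; elim: n => [|n IH] /=; rewrite ?mulr0 ?mul0r//.
  rewrite -scalerAr -scalerAl mulrDr mulrDl cu; congr (_ *: (_ + _)).
  by rewrite mulrA IH -mulrA IH mulrA.
have w1 n : nrm (w n) <= 1 by have := wv n; have := v01 n; lra.
have l1 : nrm l <= 1.
  apply/ler_addgt0Pr => e /lim[N /(_ _ (leqnn N))].
  rewrite nrmB => lN; have := nrmD (l - w N) (w N); rewrite subrK.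
  by have := w1 N; lra.
have ls : l^!* = l.
  apply/eqP; rewrite -subr_eq0; apply/eqP; apply: (nrm_le_eps _ 2) => e.
  move=> /lim[N /(_ _ (leqnn N)) lN].
  have -> : l^!* - l = (w N - l) - (w N - l)^!* by rewrite starB ws; ncring.
  by have := nrmD (w N - l) (- (w N - l)^!*); rewrite nrmN nrm_star; lra.
have lc c : c * u = u * c -> c * l = l * c.
  move=> cu; apply/eqP; rewrite -subr_eq0; apply/eqP.
  apply: (nrm_le_eps _ (2 * nrm c)) => e /lim[N /(_ _ (leqnn N)) lN].
  have -> : c * l - l * c = (w N - l) * c - c * (w N - l).
    by rewrite mulrBr mulrBl wc//; ncring.
  have := nrmD ((w N - l) * c) (- (c * (w N - l))); rewrite nrmN.
  have := nrmM (w N - l) c; have := nrmM c (w N - l); have := nrm_ge0 c.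
  nra.
have lE : l = halve (u + l * l).
  apply/eqP; rewrite -subr_eq0; apply/eqP.
  apply: (nrm_le_eps _ 2) => e /lim[N lN].
  (* The fixed-point defect of [l] is expressed through [w N] and [w N.+1], both within [e] of
     [l]. *)
  have -> : l - halve (u + l * l) =
      halve ((w N - l) * w N + l * (w N - l)) - (w N.+1 - l).
    have -> : w N.+1 = halve (u + w N * w N) by [].
    rewrite opprB addrCA; congr (_ + _); rewrite /halve -scalerBr -scalerN.
    congr (_ *: _); ncring.
  have := nrmD (halve ((w N - l) * w N + l * (w N - l))) (- (w N.+1 - l)).
  rewrite nrmZr ger0_norm ?invr_ge0 ?ler0n// nrmN.
  have := nrmD ((w N - l) * w N) (l * (w N - l)).
  have := nrmM (w N - l) (w N); have := nrmM l (w N - l).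
  have := lN _ (leqnn N); have := lN _ (leqnSn N).
  have := w1 N; have := nrm_ge0 (w N - l).
  move=> a0 a1 a2 a3 a4 a5 a6 a7.
  have le1 : nrm (w N - l) * nrm (w N) <= nrm (w N - l) * 1 by apply: ler_wpM2l.
  have le2 : nrm l * nrm (w N - l) <= 1 * nrm (w N - l) by apply: ler_wpM2r.
  lra.
exists (1 - l); split.
- by rewrite starB star1 ls.
- by rewrite subKr.
- have -> : (1 - l) * (1 - l) = 1 - (l + l) + l * l by ncring.
  by rewrite {1 2}lE halve_add /u; ncring.
- move=> c ch; rewrite mulrBr mulrBl mulr1 mul1r lc//.
  by rewrite /u mulrBr mulrBl ch mulr1 mul1r.
Qed.

(** In this form, sums and nonnegative multiples need only the triangle inequality; [positive_pos]
    and [pos_positive] identify it with spectral positivity. *)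
Definition pos h := h^!* = h /\ exists M, nrm (sc M - h) <= M.

Lemma pos_sc M : 0 <= M -> pos (sc M).
Proof.
by move=> M0; split; [exact: star_sc|exists M; rewrite subrr nrm0].
Qed.

Lemma posD x y : pos x -> pos y -> pos (x + y).
Proof.
move=> [xs [M xM]] [ys [N yN]]; split; first by rewrite starD xs ys.
exists (M + N); rewrite scD opprD addrACA.
by apply: le_trans (nrmD _ _) _; rewrite lerD.
Qed.

Lemma posZ M x : 0 <= M -> pos x -> pos (M%:C *: x).
Proof.
move=> M0 [xs [N xN]]; split; first by rewrite starZr xs.
exists (M * N); rewrite scM mul_sc -scalerBr nrmZr ger0_norm//.
exact: ler_wpM2l.
Qed.

Lemma pos_sub h K : h^!* = h -> nrm h <= K -> pos (sc K - h).
Proof.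
by move=> hs hK; split; [rewrite starB hs star_sc|exists K; rewrite subKr].
Qed.

Lemma pos_sqrt h : pos h -> exists s, [/\ s^!* = s, pos s, s * s = h &
  forall c, c * h = h * c -> c * s = s * c].
Proof.
move=> [hs [M hM]].
have M0 : 0 <= M by apply: le_trans hM; exact: nrm_ge0.
(* The added 1 makes [N] invertible even if [M = 0]; division by [N] then reduces to the unit
   ball. *)
pose N := M + 1; have N0 : 0 < N by rewrite /N; lra.
have NV0 : N^-1 * N = 1 by rewrite mulVf// gt_eqF.
have hN : nrm (sc N - h) <= N.
  rewrite /N scD sc1 addrAC; have := nrmD (sc M - h) 1; rewrite nrm1; lra.
have [||s [ss s1 sq sc']] := sqrt_unit_ball ((N^-1)%:C *: h) _ _.
- by rewrite starZr hs.
- have -> : 1 - (N^-1)%:C *: h = (N^-1)%:C *: (sc N - h).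
    by rewrite scalerBr -(mul_sc _ (sc N)) -scM NV0 sc1.
  rewrite nrmZr ger0_norm; last by rewrite invr_ge0 ltW.
  by rewrite ler_pdivrMl ?mulr1.
have sN0 : 0 <= Num.sqrt N by exact: sqrtr_ge0.
exists ((Num.sqrt N)%:C *: s); split.
- by rewrite starZr ss.
- by apply: posZ => //; split=> //; exists 1; rewrite sc1.
- rewrite -scalerAr -scalerAl scalerA sq scalerA -!rmorphM -expr2.
  by rewrite sqr_sqrtr ?(ltW N0)// mulfV ?gt_eqF// scale1r.
- move=> c ch; rewrite -scalerAr -scalerAl sc'//.
  by rewrite -scalerAr -scalerAl ch.
Qed.

Lemma star_mul_addi (s t : A) : s^!* = s -> t^!* = t -> s * t = t * s ->
  (s + 'i%C *: t)^!* * (s + 'i%C *: t) = s * s + t * t.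
Proof.
move=> ss ts st; have ii : 'i%C * 'i%C = -1 :> R[i] by rewrite -expr2 sqr_i.
rewrite starD ss starZi ts mulrBl !mulrDr -!scalerAl -!scalerAr scalerA ii.
by rewrite scaleN1r st; ncring.
Qed.

(* [t] is the imaginary part of [s + 'i t], whose norm is [sqrt N]. *)
Lemma nrm_sqr_le (s t : A) N : s^!* = s -> t^!* = t -> s * t = t * s ->
  0 <= N -> s * s + t * t = sc N -> nrm t ^+ 2 <= N.
Proof.
move=> ss ts st N0 sN.
pose U := s + 'i%C *: t.
have Us : U^!* = s - 'i%C *: t by rewrite starD ss starZi ts.
have UN : nrm U ^+ 2 = N.
  by rewrite -nrm_star_mul star_mul_addi// sN nrm_sc ger0_norm.
have tU : nrm t <= nrm U.
  have := nrmD U (- U^!*); rewrite nrmN nrm_star Us.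
  have -> : U - (s - 'i%C *: t) = 'i%C *: (t + t).
    by rewrite scalerDr /U; ncring.
  have -> : t + t = (2 : R)%:C *: t.
    have -> : 2 = 1 + 1 :> R by lra.
    by rewrite rmorphD scalerDl scale1r.
  by rewrite nrmZi nrmZr ger0_norm//; lra.
by rewrite -UN ler_sqr ?nnegrE ?nrm_ge0.
Qed.

(** The root [s] of [nrm t ^+ 2 - t * t] commutes with [t], and [s * s + t * t] is a scalar, so
    [nrm_sqr_le] bounds [nrm s]. *)
Lemma nrm_sub_sqr (t : A) : t^!* = t ->
  nrm (sc (nrm t ^+ 2) - t * t) <= nrm t ^+ 2.
Proof.
move=> ts; have tts : (t * t)^!* = t * t by rewrite star_mul ts.
have [|s [ss _ sq sc']] := pos_sqrt (sc (nrm t ^+ 2) - t * t).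
  by apply: pos_sub => //; rewrite nrm_sqr.
have st : t * s = s * t.
  by apply: sc'; rewrite mulrBr mulrBl scC mulrA.
rewrite -sq nrm_sqr//; apply: (nrm_sqr_le t s) => //; first exact: sqr_ge0.
by rewrite sq; ncring.
Qed.

Lemma pos_sqr (t : A) : t^!* = t -> pos (t * t).
Proof.
move=> ts; split; first by rewrite star_mul ts.
by exists (nrm t ^+ 2); exact: nrm_sub_sqr.
Qed.

(** Makes the radius in [pos] depend on the norm alone, which lets positivity pass to limits. *)
Lemma pos_nrm h K : pos h -> nrm h <= K -> nrm (sc K - h) <= K.
Proof.
move=> /pos_sqrt[t [ts _ <- _]]; rewrite nrm_sqr// => tK.
have := nrm_sub_sqr t ts.
have -> : sc K - t * t = sc (K - nrm t ^+ 2) + (sc (nrm t ^+ 2) - t * t).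
  by rewrite scB addrA subrK.
have := nrmD (sc (K - nrm t ^+ 2)) (sc (nrm t ^+ 2) - t * t).
rewrite nrm_sc ger0_norm ?subr_ge0//; lra.
Qed.

Lemma pos_closed h : (forall e : R, 0 < e -> pos (h + sc e)) -> pos h.
Proof.
move=> hp; have hs : h^!* = h.
  by have [+ _] := hp 1 ltr01; rewrite starD star_sc => /addIr.
split=> //; exists (nrm h + 1); apply/ler_addgt0Pr => e e0.
(* For shifts [d <= 1] the radius [nrm h + 1] works uniformly, at a cost [d <= e]. *)
pose d := Num.min e 1.
have d0 : 0 < d by rewrite lt_min e0 ltr01.
have [de d1] : d <= e /\ d <= 1 by rewrite !ge_min !lexx orbT.
have := pos_nrm (h + sc d) (nrm h + 1) (hp d d0).
have := nrmD h (sc d); rewrite nrm_sc (ger0_norm (ltW d0)) => le1 le2.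
have {le2} : nrm (sc (nrm h + 1) - (h + sc d)) <= nrm h + 1 by apply: le2; lra.
have := nrmD (sc (nrm h + 1) - (h + sc d)) (sc d).
have -> : sc (nrm h + 1) - (h + sc d) + sc d = sc (nrm h + 1) - h.
  by rewrite opprD addrA subrK.
by rewrite nrm_sc (ger0_norm (ltW d0)); lra.
Qed.

(** The roots [s] and [t] commute too, so the product is the square of the self-adjoint [s * t]. *)
Lemma pos_mul h k : pos h -> pos k -> h * k = k * h -> pos (h * k).
Proof.
move=> /pos_sqrt[s [ss _ sq sc']] /pos_sqrt[t [ts _ tq tc]] hk.
have st : t * s = s * t.
  by apply: sc'; apply/esym/tc; rewrite hk.
have -> : h * k = (s * t) * (s * t).
  by rewrite -sq -tq -!mulrA; congr (_ * _); rewrite !mulrA st.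
by apply: pos_sqr; rewrite star_mul ss ts st.
Qed.

(** The commuting roots of [p] and [- p] have squares summing to 0: the case [N = 0] of
    [nrm_sqr_le]. *)
Lemma pos_opp p : pos p -> pos (- p) -> p = 0.
Proof.
move=> /pos_sqrt[t [ts _ tq tc]] /pos_sqrt[s [ss _ sq sc']].
have st : s * t = t * s.
  by apply/esym/sc'; rewrite mulrN mulNr -tq mulrA.
suff /eqP : nrm t ^+ 2 = 0.
  by rewrite sqrf_eq0 -tq => /eqP/nrm_eq0 ->; rewrite mulr0.
apply/eqP; rewrite eq_le sqr_ge0 andbT.
by apply: (nrm_sqr_le s t) => //; rewrite sq tq addNr sc0.
Qed.

Lemma pos_exp p k : pos p -> pos (p ^+ k).
Proof.
move=> pp; elim: k => [|k IH]; first by rewrite expr0 -sc1; apply: pos_sc.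
by rewrite exprS; apply: pos_mul => //; rewrite -exprS -exprSr.
Qed.

(** * Invertible elements and positivity *)

Lemma invertible_1sub (u : A) : nrm u < 1 -> invertible (1 - u).
Proof.
move=> u1; have u0 := nrm_ge0 u.
(* Partial sums of the Neumann series, dominated by the geometric series of [nrm u]. *)
pose w := fix w n : A := if n is n.+1 then 1 + u * w n else 0.
pose v := fix v n : R := if n is n.+1 then 1 + nrm u * v n else 0.
have v0 n : 0 <= v n by elim: n => [|n IH] //=; nra.
have vB n : v n <= (1 - nrm u)^-1.
  rewrite -[leRHS]mul1r ler_pdivlMr ?subr_gt0//.
  by elim: n => [|n IH] /=; nra.
have [|l lim] := dominated_limit w v _ _ vB.
  elim=> [|n IH]; first by rewrite /= !mulr0 !addr0 !subr0 nrm1.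
  have -> : w n.+2 - w n.+1 = u * (w n.+1 - w n).
    have wS m : w m.+1 = 1 + u * w m by [].
    by rewrite (wS n.+1) [X in _ - X](wS n); move: (w n.+1) (w n) => *; ncring.
  have -> : v n.+2 - v n.+1 = nrm u * (v n.+1 - v n) by rewrite /=; ring.
  by apply: le_trans (nrmM _ _) _; rewrite ler_wpM2l.
have uw n : u * w n = w n * u.
  elim: n => [|n IH] /=; rewrite ?mulr0 ?mul0r//.
  by rewrite mulrDr mulrDl mulr1 mul1r -mulrA -IH.
have lE : l - (1 + u * l) = 0.
  apply: (nrm_le_eps _ (1 + nrm u)) => e /lim[N lN].
  have -> : l - (1 + u * l) = u * (w N - l) - (w N.+1 - l).
    have -> : w N.+1 = 1 + u * w N by [].
    by ncring.
  have := nrmD (u * (w N - l)) (- (w N.+1 - l)); rewrite nrmN.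
  have := nrmM u (w N - l); have := lN _ (leqnn N); have := lN _ (leqnSn N).
  nra.
have lu : u * l - l * u = 0.
  apply: (nrm_le_eps _ (2 * nrm u)) => e /lim[N /(_ _ (leqnn N)) lN].
  have -> : u * l - l * u = (w N - l) * u - u * (w N - l).
    by rewrite mulrBr mulrBl uw; ncring.
  have := nrmD ((w N - l) * u) (- (u * (w N - l))); rewrite nrmN.
  have := nrmM u (w N - l); have := nrmM (w N - l) u; nra.
have ul1 : (1 - u) * l = 1.
  have -> : (1 - u) * l = l - (1 + u * l) + 1 by ncring.
  by rewrite lE add0r.
exists l => //.
have -> : l * (1 - u) = (1 - u) * l + (u * l - l * u) by ncring.
by rewrite ul1 lu addr0.
Qed.

Lemma invertibleZ (c : R[i]) x : invertible (c *: x) -> invertible x.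
Proof.
move=> [y xy yx]; exists (c *: y).
  by rewrite -scalerAr scalerAl.
by rewrite -scalerAl scalerAr.
Qed.

(** Divided by [M + e], the element is [1 - (M - h) / (M + e)], a perturbation of 1 of norm at most
    [M / (M + e) < 1]. *)
Lemma pos_add_invertible h (e : R) : pos h -> 0 < e -> invertible (h + sc e).
Proof.
move=> [hs [M hM]] e0; have M0 : 0 <= M by apply: le_trans hM; exact: nrm_ge0.
have N0 : 0 < M + e by lra.
apply: (invertibleZ ((M + e)^-1)%:C).
have -> : ((M + e)^-1)%:C *: (h + sc e) = 1 - ((M + e)^-1)%:C *: (sc M - h).
  apply/eqP; rewrite eq_sym subr_eq -scalerDr.
  have -> : h + sc e + (sc M - h) = sc (M + e) by rewrite scD; ncring.
  by rewrite -(mul_sc _ (sc _)) -scM mulVf ?gt_eqF// sc1.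
apply: invertible_1sub; rewrite nrmZr ger0_norm; last by rewrite invr_ge0 ltW.
by rewrite ltr_pdivrMl ?mulr1; lra.
Qed.

Lemma star_inverse a b : a^!* = a -> a * b = 1 -> b * a = 1 -> b^!* = b.
Proof.
move=> as_ ab ba.
by rewrite -[LHS]mulr1 -ab mulrA -{1}as_ -star_mul ab star1 mul1r.
Qed.

Lemma inverse_comm a b x : a * b = 1 -> b * a = 1 -> x * a = a * x ->
  x * b = b * x.
Proof.
move=> ab ba xa.
by rewrite -[LHS]mul1r -ba -!mulrA (mulrA a) -xa -mulrA ab mulr1.
Qed.

(** For [K] above the norm of the inverse [d], [c - K^-1 = K^-1 (K - d) c] is a multiple of a
    product of commuting positive elements. *)
Lemma pos_invertible_gap (c : A) : pos c -> invertible c ->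
  exists2 d : R, 0 < d & pos (c - sc d).
Proof.
move=> cp [d cd dc]; have cs : c^!* = c by case: cp.
have ds := star_inverse c d cs cd dc.
pose K := nrm d + 1; have K0 : 0 < K by have := nrm_ge0 d; rewrite /K; lra.
exists K^-1; first by rewrite invr_gt0.
have Kp : pos (sc K - d) by apply: pos_sub => //; rewrite /K; lra.
have -> : c - sc K^-1 = (K^-1)%:C *: ((sc K - d) * c).
  rewrite mulrBl dc scalerBr mul_sc scalerA -rmorphM mulVf ?gt_eqF//.
  by rewrite scale1r.
apply: posZ; first by rewrite invr_ge0 ltW.
by apply: pos_mul => //; rewrite mulrBl mulrBr scC dc cd.
Qed.

(* At [t0 = inf {t >= 0 | pos (b + t)}] the element [b + t0] is positive; if
   [t0 > 0] it is also invertible, hence bounded below. *)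
Lemma pos_of_invertible b : b^!* = b ->
  (forall e : R, 0 < e -> invertible (b + sc e)) -> pos b.
Proof.
move=> bs binv.
pose T : set R := [set t : R | 0 <= t /\ pos (b + sc t)]%classic.
have Tn : T (nrm b).
  split; first exact: nrm_ge0.
  by rewrite addrC -[b]opprK; apply: pos_sub; rewrite ?starN ?bs ?nrmN.
have Tlb : lbound T 0 by move=> t [].
have Tinf : has_inf T by split; [exists (nrm b)|exists 0].
have t0_ge0 : 0 <= inf T by apply: lb_le_inf => //; exists (nrm b).
have bt0 : pos (b + sc (inf T)).
  apply: pos_closed => e e0.
  have [t [t_ge0 tp] te] := inf_adherent e0 Tinf.
  have -> : b + sc (inf T) + sc e = b + sc t + sc (inf T + e - t).
    by rewrite scB scD; ncring.
  by apply: posD => //; apply: pos_sc; lra.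
have [t00|t0_neq0] := eqVneq (inf T) 0; first by rewrite t00 sc0 addr0 in bt0.
have t0_gt0 : 0 < inf T by rewrite lt_def t0_neq0.
have [d d0 dp] := pos_invertible_gap _ bt0 (binv _ t0_gt0).
(* Lowering the shift by at most [d] keeps positivity, by at most [inf T] keeps it nonnegative; so
   [T] has a point below its infimum. *)
pose e := Num.min d (inf T).
have e0 : 0 < e by rewrite lt_min d0.
have : T (inf T - e).
  split; first by rewrite subr_ge0 ge_min lexx orbT.
  have -> : b + sc (inf T - e) = b + sc (inf T) - sc d + sc (d - e).
    by rewrite !scB; ncring.
  by apply: posD => //; apply: pos_sc; rewrite subr_ge0 ge_min lexx.
move=> /(ge_inf Tinf.2); lra.
Qed.

(** If [z] inverts [x y + e], then [1 - y z x] inverts [(y x + e) / e]. *)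
Lemma invertible_swap (e : R) x y : 0 < e -> invertible (x * y + sc e) ->
  invertible (y * x + sc e).
Proof.
move=> e0 [z xz zx]; apply: (invertibleZ (e^-1)%:C).
have one : 1 = (e^-1)%:C *: sc e :> A.
  by rewrite -mul_sc -scM mulVf ?gt_eqF// sc1.
exists (1 - y * z * x).
  have -> : (e^-1)%:C *: (y * x + sc e) * (1 - y * z * x) =
     (e^-1)%:C *: (y * (1 - (x * y + sc e) * z) * x) + 1.
    rewrite [X in _ = _ + X]one -scalerDr -scalerAl; congr (_ *: _).
    have : y * z * x * sc e = y * sc e * z * x.
      by rewrite -(scC e (y * z * x)) -scC !mulrA.
    rewrite -(scC e (y * z * x)) => ey.
    have -> : (y * x + sc e) * (1 - y * z * x) =
       y * x + sc e - y * x * y * z * x - sc e * (y * z * x) by ncring.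
    by rewrite ey; ncring.
  by rewrite xz subrr mulr0 mul0r scaler0 add0r.
have -> : (1 - y * z * x) * ((e^-1)%:C *: (y * x + sc e)) =
     (e^-1)%:C *: (y * (1 - z * (x * y + sc e)) * x) + 1.
  rewrite [X in _ = _ + X]one -scalerDr -scalerAr; congr (_ *: _).
  have : y * z * x * sc e = y * z * sc e * x by rewrite -!mulrA (scC e x).
  move=> ey.
  have -> : (1 - y * z * x) * (y * x + sc e) =
     y * x + sc e - y * z * x * y * x - y * z * x * sc e by ncring.
  by rewrite ey; ncring.
by rewrite zx subrr mulr0 mul0r scaler0 add0r.
Qed.

(** * Kaplansky's argument *)

Lemma star_mul_add (z : A) : pos (z^!* * z + z * z^!*).
Proof.
pose h := z + z^!*; pose k := 'i%C *: (z - z^!*).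
have hs : h^!* = h by rewrite starD starK addrC.
have ks : k^!* = k by rewrite starZi starB starK -scalerN opprB.
have -> : z^!* * z + z * z^!* = halve (h * h + k * k).
  have ii : 'i%C * 'i%C = -1 :> R[i] by rewrite -expr2 sqr_i.
  rewrite -[LHS]halve_add /halve -scalerDr; congr (_ *: _).
  rewrite /k -scalerAl -scalerAr scalerA ii scaleN1r /h; ncring.
by apply: posZ; [rewrite invr_ge0|apply: posD; exact: pos_sqr].
Qed.

(** Adding [- z^!* * z] to the element of [star_mul_add] makes [z * z^!*] positive. Its positive
    shifts are invertible, and swapping factors makes those of [z^!* * z] invertible, so [z^!* * z]
    is positive along with its opposite. *)
Lemma star_mul_opp_pos (z : A) : pos (- (z^!* * z)) -> z^!* * z = 0.
Proof.
move=> zp; apply: pos_opp => //.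
apply: pos_of_invertible; first by rewrite star_mul starK.
move=> e e0; apply: invertible_swap => //; apply: pos_add_invertible => //.
have -> : z * z^!* = (z^!* * z + z * z^!*) - z^!* * z by ncring.
by apply: posD => //; exact: star_mul_add.
Qed.

(* With [s = |h|] and [d = s - h], [z = x d] satisfies [z^!* z = - d s d],
   so that [d s d = 0]; since [d^2 = 2 s d] this forces [d = 0]. *)
Lemma star_mul_pos x : pos (x^!* * x).
Proof.
pose h := x^!* * x; have hs : h^!* = h by rewrite star_mul starK.
have [s [ss sp sq sc']] := pos_sqrt (h * h) (pos_sqr h hs).
have hsc : h * s = s * h by apply: sc'; rewrite mulrA.
pose d := s - h; have ds : d^!* = d by rewrite starB ss hs.
have dsc : d * s = s * d by rewrite mulrBr mulrBl hsc.
have dh : d * h = - (d * s).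
  apply/eqP; rewrite -addr_eq0 -mulrDr.
  have -> : d * (h + s) = (s * s - h * h) + (s * h - h * s).
    by rewrite /d; ncring.
  by rewrite sq hsc !subrr addr0.
have zz : (x * d)^!* * (x * d) = - (d * s * d).
  by rewrite star_mul ds -mulrA (mulrA x^!*) -/h mulrA dh mulNr.
have dsd : pos (d * s * d).
  have [t [ts _ tq tc]] := pos_sqrt s sp.
  have dt : d * t = t * d by exact: tc.
  have -> : d * s * d = (d * t) * (d * t) by rewrite -tq dt !mulrA dt -!mulrA.
  by apply: pos_sqr; rewrite star_mul ds ts dt.
have dsd0 : d * s * d = 0.
  by apply/eqP; rewrite -oppr_eq0 -zz star_mul_opp_pos// zz opprK.
have dd : d * d = s * d + s * d.
  have -> : d * d = s * d + s * d - (s * s - h * h) - (h * s - s * h).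
    by rewrite /d; ncring.
  by rewrite sq hsc !subrr !subr0.
have d0 : d = 0.
  (* [d^3 = 2 d s d = 0], so [d^4 = 0]; cancel squares of self-adjoint elements twice. *)
  apply: sqr_eq0 => //; apply: sqr_eq0; first by rewrite star_mul ds.
  have ddd : d * (d * d) = 0 by rewrite dd mulrDr mulrA dsd0 addr0.
  by rewrite -mulrA ddd mulr0.
by rewrite -/h; move/eqP: d0; rewrite subr_eq0 => /eqP <-.
Qed.

Lemma pos_conj x (p : A) : pos p -> pos (x^!* * p * x).
Proof.
move=> /pos_sqrt[t [ts _ <- _]].
have -> : x^!* * (t * t) * x = (t * x)^!* * (t * x).
  by rewrite star_mul ts !mulrA.
exact: star_mul_pos.
Qed.

Lemma positive_pos (p : A) : positive p -> pos p.
Proof.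
move=> [ps pspec]; apply: pos_of_invertible => // e e0.
have : invertible (-1 *: (p + sc e)).
  apply: contrapT => ninv.
  suff : (0 : R[i]) <= (- e)%:C by rewrite lecR; lra.
  apply: pspec => /=; rewrite /spectrum /=.
  suff -> : (- e)%:C%:A - p = -1 *: (p + sc e) by [].
  by rewrite -/(sc (- e)) scN scaleN1r opprD addrC.
exact: invertibleZ.
Qed.

Lemma invertible_factor x y : x * y = y * x -> invertible (x * y) ->
  invertible x.
Proof.
move=> xy [z xyz zxy].
have zyx : z * y * x = 1 by rewrite -mulrA -xy.
exists (y * z); first by rewrite mulrA.
have -> : y * z = z * y; last exact: zyx.
by rewrite -[LHS]mul1r -zyx -mulrA (mulrA x) xyz mulr1.
Qed.

(** For [l = u + i v] with [v] nonzero and [m = p - u], [i v - m] is a commuting factor of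
    [m^2 + v^2], which is invertible. For [l] real and negative, [p - l] is an invertible shift. *)
Lemma pos_positive (p : A) : pos p -> positive p.
Proof.
move=> pp; have ps : p^!* = p by case: pp.
split=> // -[u v] lp; apply: contrapT => l0; apply: lp.
have [v0|v0] := eqVneq v 0.
  have u0 : u < 0.
    by rewrite ltNge; apply/negP => u0; apply: l0; rewrite lecE /= v0 eqxx.
  apply: (invertibleZ (-1)).
  have -> : -1 *: ((u +i* v)%:A - p) = p + sc (- u).
    by rewrite v0 scaleN1r opprB scN.
  by apply: pos_add_invertible; rewrite ?oppr_gt0.
pose m := p - sc u; pose j : A := (0 +i* v)%:A.
have ms : m^!* = m by rewrite starB ps star_sc.
have -> : (u +i* v)%:A - p = j - m.
  have -> : (u +i* v) = u%:C + (0 +i* v).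
    by apply/eqP; rewrite eq_complex /= addr0 add0r !eqxx.
  by rewrite scalerDl /m /j /sc; ncring.
have jj : j * j = - sc (v ^+ 2).
  rewrite /j -scalerAl mul1r scalerA -scN /sc; congr (_ *: _).
  by apply/eqP; rewrite eq_complex /= !mul0r !mulr0 addr0 sub0r expr2 !eqxx.
have jm : j * m = m * j by rewrite /j -scalerAl -scalerAr mul1r mulr1.
apply: (invertible_factor _ (- (m + j))).
  have -> : (j - m) * - (m + j) =
      - (m + j) * (j - m) + (m * j - j * m) + (m * j - j * m) by ncring.
  by rewrite jm subrr !addr0.
have -> : (j - m) * - (m + j) = m * m + sc (v ^+ 2).
  have -> : (j - m) * - (m + j) = m * m - j * j + (m * j - j * m) by ncring.
  by rewrite jj jm subrr addr0 opprK.
by apply: pos_add_invertible; [exact: pos_sqr|rewrite exprn_even_gt0].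
Qed.

(** * Absolute values *)

Lemma cstar_absP x : pos (cstar_abs x) /\ cstar_abs x * cstar_abs x = x^!* * x.
Proof.
have [s [_ sp sq _]] := pos_sqrt _ (star_mul_pos x).
have [/positive_pos] : positive (cstar_abs x) /\ cstar_abs x ^+ 2 = x^!* * x.
  (* Since a positive root exists, [xget] returns one rather than its default value. *)
  apply: (@xgetPex _ 0 [set b | positive b /\ b ^+ 2 = x^!* * x]%classic).
  by exists s; split; [exact: pos_positive|rewrite expr2].
by rewrite expr2.
Qed.

(* [w = x |x| - |x^!*| x] satisfies the Sylvester equation
   [|x^!*| w + w |x| = 0], in which both coefficients are positive. *)
Lemma abs_intertwine x : x * cstar_abs x = cstar_abs (x^!*) * x.
Proof.
have [bp bb] := cstar_absP x; have [cp cc] := cstar_absP (x^!*).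
move: (cstar_abs x) (cstar_abs x^!*) bp bb cp cc => b c bp bb cp.
rewrite starK => cc.
have bs : b^!* = b by case: bp.
have cs : c^!* = c by case: cp.
pose w := x * b - c * x.
have cw : c * w = - (w * b).
  apply/eqP; rewrite -addr_eq0; apply/eqP.
  have -> : c * w + w * b = x * (b * b) - (c * c) * x by rewrite /w; ncring.
  by rewrite bb cc; ncring.
have wcw : pos (w^!* * c * w) by exact: pos_conj.
have wwb : w^!* * w * b = - (w^!* * c * w).
  by rewrite -!mulrA -mulrN cw opprK.
have wws : (w^!* * w)^!* = w^!* * w by rewrite star_mul starK.
(* [w^!* * w * b] is the opposite of the self-adjoint [w^!* * c * w], so its factors commute; it is
   then positive together with its opposite. *)
have bww : b * (w^!* * w) = w^!* * w * b.
  apply: star_inj; rewrite [in LHS]star_mul wws bs wwb starN.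
  by case: wcw => -> _; rewrite -wwb.
have wwbp : pos (w^!* * w * b) by apply: pos_mul => //; exact: star_mul_pos.
have wcw0 : w^!* * c * w = 0 by apply: pos_opp => //; rewrite -wwb.
have cw0 : c * w = 0.
  have [t [ts _ tq _]] := pos_sqrt c cp.
  suff tw : t * w = 0 by rewrite -tq -mulrA tw mulr0.
  by apply: star_mul_eq0; rewrite star_mul ts -mulrA (mulrA t) tq mulrA.
have wb0 : w * b = 0 by apply/eqP; rewrite -oppr_eq0 -cw cw0.
have w0 : w = 0; last by apply/eqP; rewrite -subr_eq0 -/w w0.
apply: star_mul_eq0; apply: sqr_eq0 => //.
have wsc : w^!* * c = 0 by apply: star_inj; rewrite star_mul starK cs cw0 star0.
have {1}-> : w^!* * w = w^!* * x * b.
  by rewrite {2}/w mulrBr !mulrA wsc mul0r subr0.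
by rewrite -mulrA bww -(mulrA w^!* w) wb0 !mulr0.
Qed.

(** A perturbation along [k] is dominated by a scalar one, since [nrm k + 1 - k] is positive. *)
Lemma pos_closed_dir h k : k^!* = k ->
  (forall e : R, 0 < e -> pos (h + e%:C *: k)) -> pos h.
Proof.
move=> ks hk; apply: pos_closed => e e0.
have K0 : 0 < nrm k + 1 by have := nrm_ge0 k; lra.
pose d := e / (nrm k + 1); have d0 : 0 < d by rewrite divr_gt0.
have -> : h + sc e = (h + d%:C *: k) + d%:C *: (sc (nrm k + 1) - k).
  rewrite scalerBr -(mul_sc _ (sc _)) -scM /d mulfVK ?gt_eqF//; ncring.
apply: posD; first exact: hk.
by apply: posZ; [exact: ltW|apply: pos_sub => //; lra].
Qed.

(* With [d = (|x| + e)^-1] and [y = (|x| + e) b + x^!* a], the element plus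
   [e b^!* b] equals [y^!* d y + a^!* (q - x d x^!* ) a], where [q = |x^!*|]. *)
Lemma abs_block_pos a b x :
  pos (b^!* * cstar_abs x * b + a^!* * cstar_abs (x^!*) * a
       + (a^!* * x * b + b^!* * x^!* * a)).
Proof.
have [pp _] := cstar_absP x; have [qp qq] := cstar_absP (x^!*).
rewrite starK in qq; move: (abs_intertwine x).
move: (cstar_abs x) (cstar_abs x^!*) pp qp qq => p q pp qp qq xp.
apply: (pos_closed_dir _ (b^!* * b)); first by rewrite star_mul starK.
move=> e e0.
have [d ped dpe] := pos_add_invertible _ _ pp e0.
have [g qeg gqe] := pos_add_invertible _ _ qp e0.
set pe := p + sc e in ped dpe; set qe := q + sc e in qeg gqe.
have pes : pe^!* = pe by case: pp => ps _; rewrite starD ps star_sc.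
have qes : qe^!* = qe by case: qp => qs _; rewrite starD qs star_sc.
have ds : d^!* = d by apply: star_inverse pes ped dpe.
have gs : g^!* = g by apply: star_inverse qes qeg gqe.
have dp : pos d.
  have -> : d = d^!* * pe * d by rewrite ds dpe mul1r.
  by apply: pos_conj; apply: posD => //; apply/pos_sc/ltW.
have gp : pos g.
  have -> : g = g^!* * qe * g by rewrite gs gqe mul1r.
  by apply: pos_conj; apply: posD => //; apply/pos_sc/ltW.
have xd : x * d = g * x.
  have xpe : x * pe = qe * x by rewrite mulrDr mulrDl xp scC.
  by rewrite -[LHS]mul1r -gqe -mulrA (mulrA qe) -xpe -!mulrA ped mulr1.
have qg : q * g = g * q.
  by apply: (inverse_comm qe) => //; rewrite mulrDr mulrDl scC.
(* As [x d = g x] and [x x^!* = q^2], this is [q - g q^2 = e g q]. *)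
have gap : pos (q - x * d * x^!*).
  have -> : q - x * d * x^!* = e%:C *: (g * q).
    have -> : x * d * x^!* = g * q * q by rewrite xd -!mulrA -qq.
    rewrite -[X in X - _]mul1r -gqe scalerAr -mul_sc /qe; ncring.
  by apply: posZ; [exact: ltW|exact: pos_mul].
have -> : b^!* * p * b + a^!* * q * a + (a^!* * x * b + b^!* * x^!* * a)
    + e%:C *: (b^!* * b)
  = (pe * b + x^!* * a)^!* * d * (pe * b + x^!* * a)
    + a^!* * (q - x * d * x^!*) * a.
  rewrite starD !star_mul starK pes.
  have -> : (b^!* * pe + a^!* * x) * d * (pe * b + x^!* * a) =
    b^!* * (pe * d) * pe * b + b^!* * (pe * d) * x^!* * a
    + a^!* * x * (d * pe) * b + a^!* * x * d * x^!* * a by ncring.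
  by rewrite ped dpe -mul_sc mulrA scC /pe; ncring.
by apply: posD; exact: pos_conj.
Qed.

(** For numbers [t >= 0], [t - c] and [t^k - c^k] never have opposite signs. The induction step adds
    [(p - c)^2 p^k] to [c] times the previous case. *)
Lemma pos_chebyshev (p : A) (c : R) k : pos p -> 0 <= c ->
  pos ((p - sc c) * (p ^+ k - sc (c ^+ k))).
Proof.
move=> pp c0; elim: k => [|k IH].
  by rewrite !expr0 sc1 subrr mulr0 -sc0; exact: pos_sc.
have ps : p^!* = p by case: pp.
have pcs : (p - sc c)^!* = p - sc c by rewrite starB ps star_sc.
have -> : (p - sc c) * (p ^+ k.+1 - sc (c ^+ k.+1)) =
    (p - sc c) * (p - sc c) * p ^+ k
    + c%:C *: ((p - sc c) * (p ^+ k - sc (c ^+ k))).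
  by rewrite -mul_sc (mulrA (sc c)) (scC c (p - sc c)) !exprS scM; ncring.
apply: posD; last exact: posZ.
apply: pos_mul; [exact: pos_sqr|exact: pos_exp|].
have pcp : (p - sc c) * p = p * (p - sc c) by rewrite mulrBr mulrBl scC.
have /commrX : GRing.comm ((p - sc c) * (p - sc c)) p.
  by rewrite /GRing.comm -mulrA pcp mulrA pcp mulrA.
by move=> /(_ k).
Qed.

End Order.

(** * States *)

Section State.
Context {R : realType} {A : cstarAlgType R}.
Implicit Types (a b h x y : A) (f : {scalar A}).

Lemma normc_sqr (z : R[i]) :
  normc z ^+ 2 = complex.Re z ^+ 2 + complex.Im z ^+ 2.
Proof. by case: z => u v /=; rewrite sqr_sqrtr ?addr_ge0 ?sqr_ge0. Qed.

Lemma normc_ge0 (z : R[i]) : 0 <= normc z.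
Proof. by case: z => u v; exact: sqrtr_ge0. Qed.

Lemma state_bound f a : state f -> normc (f a) <= nrm a.
Proof.
move=> [_ _ fn]; have [a0|a0] := eqVneq (nrm a) 0.
  by rewrite (nrm_eq0 _ a0) linear0 normc0 nrm_ge0.
have a_gt0 : 0 < nrm a by rewrite lt_def a0 nrm_ge0.
have : ((normc (f (((nrm a)^-1)%:C *: a)))%:E <= opnorm f)%E.
  apply: ereal_sup_ubound; exists (((nrm a)^-1)%:C *: a) => //=.
  by rewrite nrmE nrmZr ger0_norm ?invr_ge0 ?nrm_ge0// mulVf.
rewrite fn lee_fin linearZ /= -/(_ *: _) normcM normc_real.
by rewrite ger0_norm ?invr_ge0 ?nrm_ge0// ler_pdivrMl ?mulr1.
Qed.

Lemma state_sc f (M : R) : state f -> f (sc M) = M%:C.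
Proof. by move=> [_ f1 _]; rewrite /sc linearZ /= f1 mulr1. Qed.

(* The bound [|f (h + 'i t)|^2 <= nrm h ^2 + t^2] for all real [t]. *)
Lemma state_real f h : state f -> h^!* = h -> complex.Im (f h) = 0.
Proof.
move=> fs hs; set v := complex.Im (f h).
have le t : v ^+ 2 + 2 * v * t <= nrm h ^+ 2.
  have := state_bound f (h + 'i%C *: sc t) fs.
  set y := h + _.
  have yy : nrm y ^+ 2 <= nrm h ^+ 2 + t ^+ 2.
    rewrite -nrm_star_mul.
    have -> : y^!* * y = h * h + sc (t * t).
      by rewrite star_mul_addi ?star_sc ?scM ?scC.
    apply: le_trans (nrmD _ _) _; rewrite nrm_sqr// nrm_sc -expr2 ger0_norm//.
    exact: sqr_ge0.
  rewrite -ler_sqr ?nnegrE ?nrm_ge0 ?normc_ge0// normc_sqr => fy.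
  have : complex.Im (f y) = v + t.
    rewrite /y linearD linearZ /= state_sc// /v.
    by case: (f h) => p q /=; rewrite mul1r mul0r add0r.
  by move=> fyE; rewrite fyE in fy; nra.
apply/eqP; apply: contraT => v0.
(* This [t] gives [v^2 + 2 (nrm h)^2 <= (nrm h)^2], impossible for [v] nonzero. *)
have := le (nrm h ^+ 2 / v).
have -> : 2 * v * (nrm h ^+ 2 / v) = 2 * nrm h ^+ 2 by field.
have : 0 < v ^+ 2 by rewrite exprn_even_gt0.
have := sqr_ge0 (nrm h); lra.
Qed.

Definition state_re f a : R := complex.Re (f a).

Lemma state_reE f h : state f -> h^!* = h -> f h = (state_re f h)%:C.
Proof.
move=> fs hs; have := state_real f h fs hs; rewrite /state_re.
by case: (f h) => p q /= ->.
Qed.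

Lemma state_reD f x y : state_re f (x + y) = state_re f x + state_re f y.
Proof. by rewrite /state_re linearD; case: (f x); case: (f y). Qed.

Lemma state_reZ f (M : R) x : state_re f (M%:C *: x) = M * state_re f x.
Proof.
by rewrite /state_re linearZ /=; case: (f x) => p q /=; rewrite mul0r subr0.
Qed.

Lemma state_reN f x : state_re f (- x) = - state_re f x.
Proof. by rewrite /state_re linearN; case: (f x). Qed.

Lemma state_re_sc f (M : R) : state f -> state_re f (sc M) = M.
Proof. by move=> fs; rewrite /state_re state_sc. Qed.

(** [M - f h] is real of modulus at most [M]. *)
Lemma state_re_ge0 f h : state f -> pos h -> 0 <= state_re f h.
Proof.
move=> fs [hs [M hM]].
have := state_bound f (sc M - h) fs.
rewrite linearB /= state_sc// (state_reE f h)// -rmorphB normc_real.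
by move=> /le_trans /(_ hM); rewrite ler_norml; lra.
Qed.

Lemma state_star f y : state f -> f (y^!*) = (f y)^*%C.
Proof.
move=> fs.
have := state_real f (y + y^!*) fs; rewrite starD starK addrC => /(_ erefl).
have := state_real f ('i%C *: (y - y^!*)) fs.
rewrite starZi starB starK -scalerN opprB => /(_ erefl).
rewrite linearZ linearB linearD /=; case: (f y) (f y^!*) => p q [u v] /=.
by rewrite !mul0r !mul1r add0r => pu qv; apply/eqP; rewrite eq_complex /=; lra.
Qed.

(** Multiplying [b] by the phase [c], minus the conjugate of [z] over its modulus, fixes the
    diagonal terms of [abs_block_pos] and turns each cross term into [- normc z]. *)
Lemma state_abs_le f a b x : state f ->
  2 * normc (f (a^!* * x * b)) <=
  state_re f (b^!* * cstar_abs x * b) +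
  state_re f (a^!* * cstar_abs (x^!*) * a).
Proof.
move=> fs; set z := f _.
have [pp _] := cstar_absP x; have [qp _] := cstar_absP (x^!*).
have [z0|z0] := eqVneq z 0.
  by rewrite z0 normc0 mulr0 addr_ge0// state_re_ge0//; exact: pos_conj.
have nz0 : normc z != 0 by apply: contra z0 => /eqP/eq0_normc ->.
pose c : R[i] := - z^*%C * ((normc z)^-1)%:C.
have zz : z^*%C * z = ((normc z) ^+ 2)%:C.
  rewrite normc_sqr; case: (z) => u v /=; apply/eqP; rewrite eq_complex /=.
  by apply/andP; split; apply/eqP; ring.
have cz : c * z = (- normc z)%:C.
  rewrite /c mulrAC mulNr zz -rmorphN -rmorphM; congr (_%:C).
  by rewrite expr2; field.
have cc : c^*%C * c = 1.
  have -> : c^*%C = - z * ((normc z)^-1)%:C.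
    rewrite /c rmorphM rmorphN.
    by congr (- _ * _); [exact: conjcK|exact: conjc_real].
  rewrite /c mulrACA mulrNN (mulrC z) zz.
  by rewrite -!rmorphM expr2 mulrACA divff// mulr1.
have := state_re_ge0 f _ fs (abs_block_pos a (c *: b) x).
have -> : (c *: b)^!* * cstar_abs x * (c *: b) = b^!* * cstar_abs x * b.
  by rewrite starZ -scalerAr -!scalerAl scalerA mulrC cc scale1r.
rewrite !state_reD.
have -> : (c *: b)^!* * x^!* * a = (a^!* * x * (c *: b))^!*.
  by rewrite !star_mul starK mulrA.
have -> : state_re f (a^!* * x * (c *: b)) = - normc z.
  by rewrite -scalerAr /state_re linearZ /= -/z cz.
have -> : state_re f (a^!* * x * (c *: b))^!* = - normc z.
  by rewrite -scalerAr /state_re state_star// linearZ /= -/z cz.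
lra.
Qed.

(** With [c = f p], applying [f] to [pos_chebyshev] leaves [c f(p^k) <= f(p^(k+1))]. *)
Lemma state_exp f p k : state f -> pos p ->
  state_re f p ^+ k <= state_re f (p ^+ k).
Proof.
move=> fs pp; set c := state_re f p; have c0 : 0 <= c by exact: state_re_ge0.
elim: k => [|k IH]; first by rewrite !expr0 -sc1 state_re_sc.
have := state_re_ge0 f _ fs (pos_chebyshev p c k pp c0).
rewrite mulrBr !mulrBl -exprS mul_sc mulx_sc -scM.
rewrite !(state_reD, state_reN) state_re_sc// !state_reZ -/c exprS.
have : c * c ^+ k <= c * state_re f (p ^+ k) by rewrite ler_wpM2l.
rewrite exprS; nra.
Qed.

End State.

(** * Scalar inequalities *)

(** The left side is the tangent line to [t^(k+1)] at [m]; the induction step gains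
    [(k+1) m^k (t - m)^2]. *)
Lemma tangent_le (R : realFieldType) (m t : R) k : 0 <= m -> 0 <= t ->
  m ^+ k * (k.+1%:R * t - k%:R * m) <= t ^+ k.+1.
Proof.
move=> m0 t0; elim: k => [|k IH].
  by rewrite expr0 expr1 mul0r subr0 !mul1r.
apply: le_trans (_ : t * (m ^+ k * (k.+1%:R * t - k%:R * m)) <= _); last first.
  by rewrite [leRHS]exprS ler_wpM2l.
have : 0 <= k.+1%:R * m ^+ k * (t - m) ^+ 2.
  by apply: mulr_ge0 (sqr_ge0 _); rewrite mulr_ge0 ?exprn_ge0 ?ler0n.
rewrite -subr_ge0 => h; rewrite -subr_ge0; move: h; rewrite subr0.
apply: etrans; congr (_ <= _).
rewrite [m ^+ k.+1]exprS -![_.+1%:R]natr1; ring.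
Qed.

(** Sum the tangent inequalities at the mean [m] of the [y i]. *)
Lemma power_mean (R : realFieldType) n (y : 'I_n -> R) k : (0 < n)%N ->
  (forall i, 0 <= y i) ->
  (\sum_(i < n) y i) ^+ k.+1 <= n%:R ^+ k * \sum_(i < n) y i ^+ k.+1.
Proof.
move=> n0 y0; set S := \sum_(i < n) y i.
have n_gt0 : 0 < n%:R :> R by rewrite ltr0n.
have S0 : 0 <= S by apply: sumr_ge0.
pose m := S / n%:R; have m0 : 0 <= m by rewrite divr_ge0 ?ler0n.
have Sm : S = n%:R * m by rewrite /m mulrC divfK ?gt_eqF.
have : \sum_(i < n) m ^+ k * (k.+1%:R * y i - k%:R * m) <=
    \sum_(i < n) y i ^+ k.+1.
  by apply: ler_sum => i _; apply: tangent_le.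
rewrite -mulr_sumr sumrB -mulr_sumr -/S sumr_const card_ord.
rewrite -[_ *+ n]mulr_natl => le.
have -> : S ^+ k.+1 = n%:R ^+ k * (m ^+ k * (k.+1%:R * S - n%:R * (k%:R * m))).
  by rewrite Sm exprMn !exprSr -natr1; ring.
by rewrite ler_wpM2l// exprn_ge0// ler0n.
Qed.

Lemma midpoint_power (R : realFieldType) (p q : R) k : 0 <= p -> 0 <= q ->
  ((p + q) / 2) ^+ k.+1 <= (p ^+ k.+1 + q ^+ k.+1) / 2.
Proof.
move=> p0 q0; set m := (p + q) / 2.
have m0 : 0 <= m by rewrite /m; lra.
have := tangent_le _ m p k m0 p0; have := tangent_le _ m q k m0 q0.
have -> : m ^+ k.+1 = (m ^+ k * (k.+1%:R * p - k%:R * m) +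
    m ^+ k * (k.+1%:R * q - k%:R * m)) / 2.
  by rewrite exprSr -natr1 /m; field.
lra.
Qed.

Lemma normc_sum (R : rcfType) n (z : 'I_n -> R[i]) :
  normc (\sum_(i < n) z i) <= \sum_(i < n) normc (z i).
Proof.
elim/big_ind2: _ => [|a b c d ab cd|//]; first by rewrite normc0.
by apply: le_trans (le_normcD _ _) _; rewrite lerD.
Qed.

(** Source of the factor [1 / sqrt 2]: [(u + v)^2 <= 2 (u^2 + v^2)]. *)
Lemma add_le_normc (R : rcfType) (u v : R) :
  (u + v) / 2 <= normc (u +i* v) / Num.sqrt 2.
Proof.
have s2 : 0 < Num.sqrt 2 :> R by rewrite sqrtr_gt0.
have ss : Num.sqrt 2 ^+ 2 = 2 :> R by rewrite sqr_sqrtr.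
rewrite ler_pdivlMr// mulrAC ler_pdivrMr//.
have N0 : 0 <= normc (u +i* v) by exact: sqrtr_ge0.
have NN : normc (u +i* v) ^+ 2 = u ^+ 2 + v ^+ 2.
  by rewrite /= sqr_sqrtr// addr_ge0 ?sqr_ge0.
apply: le_trans (ler_norm _) _.
rewrite -ler_sqr ?nnegrE ?mulr_ge0// real_normK ?num_real//.
rewrite exprMn ss exprMn NN; have := sqr_ge0 (u - v); nra.
Qed.

(** * Sums and the numerical radius *)

Lemma state_sum_le (R : realType) (A : cstarAlgType R) (n : nat)
    (n_gt0 : (0 < n)%N) (a b x : 'I_n -> A) (f : {scalar A})
    (r : nat) :
  state f -> (0 < r)%N ->
  normc (f (\sum_(k < n) (a k)^!* * x k * b k)) ^+ r
    <= n%:R ^+ r.-1 / Num.sqrt 2 *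
       normc (f (\sum_(k < n)
         (((b k)^!* * cstar_abs (x k) * b k) ^+ r +
          'i%C *: ((a k)^!* * cstar_abs ((x k)^!*) * a k) ^+ r))).
Proof.
move=> fs; case: r => // r _; rewrite [r.+1.-1]/=.
pose P k := (b k)^!* * cstar_abs (x k) * b k.
pose Q k := (a k)^!* * cstar_abs ((x k)^!*) * a k.
have Pp k : pos (P k) by apply: pos_conj; case: (cstar_absP (x k)).
have Qp k : pos (Q k) by apply: pos_conj; case: (cstar_absP (x k)^!*).
have self (p : A) : pos p -> p^!* = p by case.
have P0 k := state_re_ge0 f _ fs (Pp k).
have Q0 k := state_re_ge0 f _ fs (Qp k).
pose y k := (state_re f (P k) + state_re f (Q k)) / 2.
have y0 k : 0 <= y k by rewrite /y; have := P0 k; have := Q0 k; lra.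
have S1 : normc (f (\sum_(k < n) (a k)^!* * x k * b k)) <= \sum_(k < n) y k.
  rewrite linear_sum /=; apply: le_trans (normc_sum _ _ _) _.
  apply: ler_sum => k _; have := state_abs_le f (a k) (b k) (x k) fs.
  by rewrite -/(P k) -/(Q k) /y; lra.
apply: le_trans (_ : (\sum_(k < n) y k) ^+ r.+1 <= _).
  by apply: lerXn2r S1; rewrite nnegrE ?normc_ge0// sumr_ge0.
apply: le_trans (power_mean _ _ _ _ n_gt0 y0) _.
rewrite -!mulrA ler_wpM2l ?exprn_ge0 ?ler0n// mulrC.
set u := \sum_(k < n) state_re f (P k ^+ r.+1).
set v := \sum_(k < n) state_re f (Q k ^+ r.+1).
(* Powers of positive elements are self-adjoint, so [f] is real on them. *)
have -> : f (\sum_(k < n) (P k ^+ r.+1 + 'i%C *: Q k ^+ r.+1)) = u +i* v.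
  have -> : u +i* v = u%:C + 'i%C * v%:C.
    by apply/eqP; rewrite eq_complex /=; apply/andP; split; apply/eqP; ring.
  rewrite linear_sum /u /v !rmorph_sum mulr_sumr -big_split /=.
  apply: eq_bigr => k _; rewrite linearD linearZ /=.
  by congr (_ + _ * _); apply: state_reE => //; apply/self/pos_exp.
apply: le_trans (add_le_normc _ u v).
rewrite /u /v -big_split /= mulr_suml; apply: ler_sum => k _.
apply: le_trans (midpoint_power _ _ _ r (P0 k) (Q0 k)) _.
have := state_exp f _ r.+1 fs (Pp k); have := state_exp f _ r.+1 fs (Qp k); lra.
Qed.

(** The sign of [c] covers the empty set, whose [sup] is 0. *)
Lemma sup_le_nonneg (R : realType) (E : set R) (c : R) : 0 <= c ->
  ubound E c -> sup E <= c.
Proof.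
move=> c0 Ec; have [->|/set0P E0] := eqVneq E set0; first by rewrite sup0.
exact: ge_sup.
Qed.

Lemma numradius_ub (R : realType) (A : cstarAlgType R) (a : A)
    (f : {scalar A}) :
  state f -> normc (f a) <= numradius a.
Proof.
move=> fs; apply: ub_le_sup; last by exists f.
by exists (nrm a) => _ [g gs <-]; exact: state_bound.
Qed.

Lemma numradius_ge0 (R : realType) (A : cstarAlgType R) (a : A) :
  0 <= numradius a.
Proof.
have [[f fs]|nf] := pselect (exists f : {scalar A}, state f).
  by apply: le_trans (numradius_ub _ _ a f fs); exact: normc_ge0.
have E0 :
    [set normc (f a) | f in [set f : {scalar A} | state f]]%classic = set0.
  by apply/seteqP; split=> [t [f fs _]|//]; case: nf; exists f.
by rewrite /numradius E0 sup0.
Qed.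

(** The r-th root [d] of the right side bounds every state's value at [s], hence their supremum;
    then raise to the power [r] again. *)
Lemma numradius_le (R : realType) (A : cstarAlgType R) (s t : A) (c : R)
    (r : nat) :
  (0 < r)%N -> 0 <= c ->
  (forall f : {scalar A}, state f -> normc (f s) ^+ r <= c * normc (f t)) ->
  numradius s ^+ r <= c * numradius t.
Proof.
move=> r0 c0 fst; set B := c * _.
have B0 : 0 <= B by rewrite mulr_ge0// numradius_ge0.
pose d := powR B r%:R^-1.
have dB : d ^+ r = B.
  by rewrite -powR_mulrn ?powR_ge0// -powRrM mulVf ?powRr1// pnatr_eq0 -lt0n.
rewrite -dB; apply: lerXn2r; rewrite ?nnegrE ?numradius_ge0 ?powR_ge0//.
apply: sup_le_nonneg; first exact: powR_ge0.
move=> _ [f fs <-].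
rewrite -(ler_pXn2r r0) ?nnegrE ?normc_ge0 ?powR_ge0// dB.
by apply: le_trans (fst f fs) _; rewrite ler_wpM2l// numradius_ub.
Qed.

Theorem theorem4p3 (R : realType) (A : cstarAlgType R) (n : nat)
    (n_gt0 : (0 < n)%N) (a b x : 'I_n -> A) :
  [/\ forall f : {scalar A}, state f -> forall r : nat, (0 < r)%N ->
        normc (f (\sum_(k < n) (a k)^!* * x k * b k)) ^+ r
        <= n%:R ^+ r.-1 / Num.sqrt 2 *
           normc (f (\sum_(k < n)
             (((b k)^!* * cstar_abs (x k) * b k) ^+ r +
              'i%C *: ((a k)^!* * cstar_abs ((x k)^!*) * a k) ^+ r))),
      forall r : nat, (0 < r)%N ->
        numradius (\sum_(k < n) (a k)^!* * x k * b k) ^+ r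
        <= n%:R ^+ r.-1 / Num.sqrt 2 *
           numradius (\sum_(k < n)
             (((b k)^!* * cstar_abs (x k) * b k) ^+ r +
              'i%C *: ((a k)^!* * cstar_abs ((x k)^!*) * a k) ^+ r))
    & numradius (\sum_(k < n) (a k)^!* * x k * b k)
      <= (Num.sqrt 2)^-1 *
         numradius (\sum_(k < n)
           ((b k)^!* * cstar_abs (x k) * b k +
            'i%C *: ((a k)^!* * cstar_abs ((x k)^!*) * a k)))].
Proof.
have state_le (f : {scalar A}) r := state_sum_le R A n n_gt0 a b x f r.
have numradius_sum_le r : (0 < r)%N -> _ := fun r0 =>
  numradius_le R A _ _ _ _ r0
    (divr_ge0 (exprn_ge0 r.-1 (ler0n R n)) (sqrtr_ge0 2))
    (fun f fs => state_le f r fs r0).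
split=> [f fs r r0|//|]; first exact: state_le.
by have := numradius_sum_le 1%N erefl; rewrite expr0 expr1 mul1r.
Qed.
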